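(* Let $q\ge2$, $d\ge1$. Let $V=(V[1],\ldots,V[d])$ be a random vector on $\mathcal V_{q,d}$ with exchangeable entries, let $(X_t)$ be the random walk on $\mathcal V_{q,d}$ with $X_{t+1}=X_t+Z_t\bmod q$, where the $Z_t$ are i.i.d. with the distribution of $V$, and let $M_t=(M_t[j])_{j=0}^{q-1}$, where $M_t[j]$ is the number of entries of $X_t$ equal to $j$. For $l=(l_1,\ldots,l_{q-1})\in\mathbb N^{q-1}$ with $|l|\le d$, let $A_l$ be the set of $r\in\mathcal V_{q,d}$ such that $|\{k\in[d]: r[k]=j\}|=l_j$ for all $j\in\mathcal V_q$ (where $l_0=d-|l|$), and put $$\kappa_l=h_l\,\mathbb E\Big[\sum_{r\in A_l}\prod_{k=1}^d\theta_{r[k]}^{V[k]}\Big].$$ Suppose the $\kappa_l$ are real. Then the following hold. (i) The transition function from $M_t=m$ to $M_{t+1}=n$ has the spectral expansion $$\mathbb P(n\mid m)=\mathfrak p(n)\Big\{1+\sum_{l:\,0<|l|\le d}\kappa_l\,h_l\,Q_l(m;(\theta_k))\,\overline{Q_l(n;(\theta_k))}\Big\},\qquad m,n\in\mathcal P_{d,q}.$$ (ii) The polynomials $Q_l(\cdot;(\theta_k))$ are orthogonal on the uniform multinomial distribution $\mathfrak p$: if $M$ has distribution $\mathfrak p$, then $\mathbb E\big[Q_l(M;(\theta_k))\overline{Q_{l'}(M;(\theta_k))}\big]=0$ for $l\neq l'$, and $$\mathbb E\big[Q_l(M;(\theta_k))\overline{Q_l(M;(\theta_k))}\big]=\frac{d!}{(d-|l|)!\,l_1!\cdots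 l_{q-1}!}=h_l^{-1}.$$ (iii) $Q_l(m;(\theta_k))$ is also the coefficient of $\binom{d}{m}s_0^{m[0]}\cdots s_{q-1}^{m[q-1]}$ in $$h_l^{-1}\Big(\sum_{j=0}^{q-1}s_j\Big)^{d-|l|}\prod_{k=1}^{q-1}\Big(\sum_{j=0}^{q-1}s_j\theta_k^j\Big)^{l_k}.$$ (iv) With $l^+=(d-|l|,l_1,\ldots,l_{q-1})$ and $m^-=(m[1],\ldots,m[q-1])$ there is the duality relationship $$h_m^{-1}\,Q_l(m;(\theta_k))=h_{l^+}^{-1}\,Q_{m^-}(l^+;(\theta_j)).$$ (v) The eigenvalues satisfy $$\kappa_l=\mathbb E\Big[\theta_1^{S_{l_1}}\theta_2^{S_{l_2}}\cdots\theta_{q-1}^{S_{l_{q-1}}}\Big],$$ where $S_{l_k}$ denotes the sum of the entries of $V$ in the $k$-th of consecutive disjoint blocks of lengths $l_1,\ldots,l_{q-1}$, i.e. $S_{l_1}=V[1]+\cdots+V[l_1]$, $S_{l_2}=V[l_1+1]+\cdots+V[l_1+l_2]$, $\ldots$, $S_{l_{q-1}}=V[l_1+\cdots+l_{q-2}+1]+\cdots+V[l_1+\cdots+l_{q-1}]$.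
   Context: $\mathcal V_q=\{0,\ldots,q-1\}$, $\mathcal V_{q,d}=\mathcal V_q^d$, $[d]=\{1,\ldots,d\}$, $\mathbb N=\{0,1,2,\ldots\}$, $\theta_l=e^{2\pi i l/q}$. Exchangeable means that the joint distribution of $(V[1],\ldots,V[d])$ is invariant under permutations of the coordinates. $\mathcal P_{d,q}$ is the set of vectors $m=(m[0],\ldots,m[q-1])$ of non-negative integers with sum $d$. For $m\in\mathcal P_{d,q}$, $\binom dm=\frac{d!}{m[0]!\cdots m[q-1]!}$, and $\mathfrak p(m)=\binom dm q^{-d}$ is the uniform multinomial distribution. For $l\in\mathbb N^{q-1}$, $|l|=l_1+\cdots+l_{q-1}$ and $h_l^{-1}=\frac{d!}{(d-|l|)!\,l_1!\cdots l_{q-1}!}$; for $m\in\mathcal P_{d,q}$, $h_m^{-1}=\binom dm$. The multivariate Krawtchouk polynomial $Q_l(m;(\theta_k))$, for $l\in\mathbb N^{q-1}$ with $|l|\le d$ and $m\in\mathcal P_{d,q}$, is the coefficient of $w_1^{l_1}\cdots w_{q-1}^{l_{q-1}}$ in $$G(m;w,q,d)=\prod_{j=0}^{q-1}\Big(1+\sum_{k=1}^{q-1}w_k\theta_k^j\Big)^{m[j]}.$$ Because $V$ is exchangeable, $(M_t)$ is a Markov chain on $\mathcal P_{d,q}$, and $\mathbb P(n\mid m)=\mathbb P(M_{t+1}=n\mid M_t=m)$. *)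

(* Defs.v *)
(* Only the notations of [mpoly] are left out: they clash with those of
   MathComp-Analysis.  [multinom n] is the type 'X_{1..n} of exponent vectors
   in N^n, [mdeg] the sum of the entries, [bmultinom n b] the finite type of
   those of degree < b, and [mpoly n F] the polynomial ring {mpoly F[n]}. *)
From HB Require Import structures.
From mathcomp Require Import all_boot all_order all_algebra fingroup perm.
From mathcomp Require Import complex.
From mathcomp Require Import all_classical all_reals all_analysis.
From mathcomp Require Import -(notations) mpoly.

Set Implicit Arguments.
Unset Strict Implicit.
Unset Printing Implicit Defensive.

Import Order.TTheory GRing.Theory Num.Theory.
Local Open Scope classical_set_scope.
Local Open Scope complex_scope.
Local Open Scope ring_scope.

(* ['Z_q] carries addition modulo q, and a : 'Z_q coerces to its representative
   in {0, ..., q-1}, as soon as 1 < q. *)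
Definition vec (q d : nat) := {ffun 'I_d -> 'Z_q}.

HB.instance Definition _ q d := GRing.Zmodule.on (vec q d).
HB.instance Definition _ q d := Finite.on (vec q d).
HB.instance Definition _ q d := isPointed.Build (vec q d) 0.
HB.instance Definition _ q d := @isMeasurable.Build default_measure_display
  (vec q d) discrete_measurable discrete_measurable0
  discrete_measurableC discrete_measurableU.

HB.instance Definition _ q := isPointed.Build (multinom q) (mnm0 (n:=q)).
HB.instance Definition _ q := @isMeasurable.Build default_measure_display
  (multinom q) discrete_measurable discrete_measurable0
  discrete_measurableC discrete_measurableU.

Section Combinatorics.
Variables (q d : nat).

Definition counts (x : vec q d) : multinom q :=
  Multinom [tuple #|[set k | (x k : nat) == j]%SET| | j < q].

(* l^+ = (d - |l|, l_1, ..., l_(q-1)); the entry l_j is stored at index j-1. *)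
Definition mplus (l : multinom q.-1) : multinom q :=
  Multinom
    [tuple nth 0%N ((d - mdeg l)%N :: multinom_val l) j | j < q].

(* m^- = (m[1], ..., m[q-1]) *)
Definition mminus (m : multinom q) : multinom q.-1 :=
  Multinom [tuple nth 0%N (multinom_val m) j.+1 | j < q.-1].

(* A_l *)
Definition type_class (l : multinom q.-1) : {set vec q d} :=
  [set r | counts r == mplus l]%SET.

Definition permute (s : 'S_d) (x : vec q d) : vec q d := [ffun k => x (s k)].

(* The sum of the entries of x over the k-th of consecutive blocks of lengths
   l_1, ..., l_(q-1) (k and the positions being counted from 0). *)
Definition block_sum (l : multinom q.-1) (x : vec q d) (k : 'I_q.-1) : nat :=
  let b := (\sum_(j < q.-1 | (j < k)%N) l j)%N in
  (\sum_(i < d | (b <= i < b + l k)%N) (x i : nat))%N.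

End Combinatorics.

Section Coefficients.
Variables (F : fieldType) (q d : nat).

(* The multinomial coefficient h_m^-1, for |m| = d. *)
Definition mbinom (m : multinom q) : F :=
  (d`!)%:R / \prod_(j < q) ((m j)`!)%:R.

(* [hcoef l] is h_l. *)
Definition hcoef (l : multinom q.-1) : F :=
  ((d`!)%:R / (((d - mdeg l)`!)%:R * \prod_(j < q.-1) ((l j)`!)%:R))^-1.

(* Extended by 0 outside |m| = d, so that it is a law on all of N^q. *)
Definition uniform_multinomial (m : multinom q) : F :=
  if mdeg m == d then mbinom m / q%:R ^+ d else 0.

End Coefficients.

Section Krawtchouk.
Variables (F : fieldType) (q : nat) (th : nat -> F).

(* G(m; w, q, d); the variable w_k is 'X_(k-1), and d = |m|. *)
Definition krawtchouk_gf (m : multinom q) : mpoly q.-1 F :=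
  \prod_(j < q)
    (1 + \sum_(k < q.-1) (th k.+1 ^+ j) *: mpolyX F (mnm1 k)) ^+ m j.

Definition krawtchouk (l : multinom q.-1) (m : multinom q) : F :=
  mcoeff l (krawtchouk_gf m).

(* The polynomial in s_0, ..., s_(q-1) generating binom(d, m) Q_l(m). *)
Definition krawtchouk_dual_gf (d : nat) (l : multinom q.-1) :
    mpoly q F :=
  (hcoef F d l)^-1 *:
    ((\sum_(j < q) mpolyX F (mnm1 j)) ^+ (d - mdeg l) *
     \prod_(k < q.-1)
       (\sum_(j < q) (th k.+1 ^+ j) *: mpolyX F (mnm1 j)) ^+ l k).

End Krawtchouk.

(* theta_l = e^(2 pi i l / q) *)
Definition theta (R : realType) (q l : nat) : R[i] :=
  let a := 2 * pi * l%:R / q%:R in cos a +i* sin a.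

Section Probability.
Variables (R : realType) (disp : measure_display) (T : measurableType disp).
Variable P : probability T R.

(* The expectation of a complex random variable with integrable real and
   imaginary parts. *)
Definition cexpectation (f : T -> R[i]) : R[i] :=
  fine 'E_P[fun w => complex.Re (f w)] +i* fine 'E_P[fun w => complex.Im (f w)].

Definition cond_prob (A B : set T) : R := fine (P (A `&` B)) / fine (P B).

(* Product rule over every finite subfamily J. *)
Definition mutually_independent (disp' : measure_display)
    (T' : measurableType disp') (I : eqType) (Y : I -> T -> T') : Prop :=
  forall (J : seq I) (B : I -> set T'),
    uniq J -> (forall i, measurable (B i)) ->
    fine (P (\bigcap_(i in [set` J]) (Y i @^-1` B i))) =
    \prod_(i <- J) fine (P (Y i @^-1` B i)).

Variables q d : nat.

Definition exchangeable (V : {RV P >-> vec q d}) : Prop :=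
  forall s : 'S_d,
    pushforward P (fun w => permute s (V w)) = distribution P V.

Definition kappa (V : {RV P >-> vec q d}) (l : multinom q.-1) : R[i] :=
  hcoef R[i] d l *
  cexpectation (fun w =>
    \sum_(r in type_class d l) \prod_(k < d) theta R q (r k) ^+ (V w k)).

(* The increments Z_t are i.i.d. with law mu; the law of X_0 is arbitrary, and
   X_0, Z_0, Z_1, ... are mutually independent. *)
Definition random_walk (mu : set (vec q d) -> \bar R)
    (X Z : nat -> {RV P >-> vec q d}) : Prop :=
  [/\ forall t, distribution P (Z t) = mu,
      mutually_independent
        (fun i : nat => if i is t.+1 then Z t : T -> vec q d else X 0%N)
    & forall t w, X t.+1 w = X t w + Z t w].

End Probability.

(* Main.v *)
(* Writing chi r x = prod_k theta_(r k) ^ (x k), expansion of the generating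
   function over the d coordinates shows that Q_l (counts x) is the sum of
   chi r x over the vectors r of type l.  As chi r x = chi x r, summing this
   over all x with counts x = m and exchanging the two sums gives the duality
   (iv), and (iii) follows by the same expansion.  The functions chi r are the
   characters of (Z/q)^d, whose orthogonality gives (ii).  By exchangeability
   E (chi r V) depends only on the type of r, hence equals kappa_l for r of
   type l, which is (v) when r is constant on consecutive blocks; Fourier
   inversion of the indicator of {counts (x + V) = n} then gives (i). *)
Require Import Defs.
From HB Require Import structures.
From mathcomp Require Import all_boot all_order all_algebra fingroup perm.
From mathcomp Require Import complex.
From mathcomp Require Import all_classical all_reals all_analysis.
From mathcomp Require Import -(notations) mpoly.
From mathcomp Require Import ring measurable_realfun.
Import Order.TTheory GRing.Theory Num.Theory.
Local Open Scope classical_set_scope.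
Local Open Scope complex_scope.
Local Open Scope ring_scope.

Set Implicit Arguments.
Unset Strict Implicit.

(** * Count vectors and types of vectors *)

Section TypeVectors.
Variables (p d : nat).
(** For q of the form p + 2 the type ['Z_q] computes to ['I_q], so an entry of a vector can itself
    index [counts]. *)
Local Notation q := p.+2.
Implicit Types (x r : vec q d) (l : multinom q.-1) (m : multinom q).

Lemma countsE x (j : 'I_q) : counts x j = #|[set k | x k == j]%SET|.
Proof. by rewrite multinomE tnth_mktuple; apply: eq_card => k; rewrite !inE. Qed.

Lemma mdeg_recl m : mdeg m = (m ord0 + mdeg (mminus m))%N.
Proof.
rewrite !mdegE big_ord_recl; congr (_ + _)%N; apply: eq_bigr => j _.
by rewrite !multinomE tnth_mktuple (mnm_nth 0%N).
Qed.

Lemma mplus0 l : mplus d (q := q) l ord0 = (d - mdeg l)%N.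
Proof. by rewrite multinomE tnth_mktuple. Qed.

Lemma mplusS l (k : 'I_q.-1) : mplus d (q := q) l (lift ord0 k) = l k.
Proof. by rewrite !multinomE tnth_mktuple /= (mnm_nth 0%N). Qed.

Lemma mminusE m (k : 'I_q.-1) : mminus m k = m (lift ord0 k).
Proof. by rewrite !multinomE tnth_mktuple (mnm_nth 0%N). Qed.

Lemma mplusK l : mminus (mplus d (q := q) l) = l.
Proof. by apply/mnmP => k; rewrite mminusE mplusS. Qed.

Lemma mminusK m : mdeg m = d -> mplus d (mminus m) = m.
Proof.
move=> dm; apply/mnmP => j; case: (unliftP ord0 j) => [k|] ->.
  by rewrite mplusS mminusE.
by rewrite mplus0 -dm mdeg_recl addnK.
Qed.

Lemma mdeg_mminus m : (mdeg (mminus m) <= mdeg m)%N.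
Proof. by rewrite mdeg_recl leq_addl. Qed.

Lemma mdeg_mplus l : (mdeg l <= d)%N -> mdeg (mplus d (q := q) l) = d.
Proof. by move=> ld; rewrite mdeg_recl mplusK mplus0 subnK. Qed.

Lemma mdeg_counts x : mdeg (counts x) = d.
Proof.
rewrite mdegE -[RHS]card_ord -sum1_card.
rewrite (partition_big x predT) //=; apply: eq_bigr => j _.
by rewrite countsE -sum1_card; apply: eq_bigl => k; rewrite inE.
Qed.

(** [mplus d] and [mminus] are inverse bijections between degrees at most d and degree exactly d,
    and [counts x] has degree d. Hence the entry at index 0 carries no extra information. *)
Lemma type_classE l x :
  (mdeg l <= d)%N -> (x \in type_class d l) = (mminus (counts x) == l).
Proof.
move=> ld; rewrite inE; apply/eqP/eqP => [->|<-]; first exact: mplusK.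
by rewrite mminusK // mdeg_counts.
Qed.

(** Coordinates are grouped by their value. This turns the products over values in generating
    functions into products over coordinates, which distributivity expands. *)
Lemma prod_counts (A : comNzRingType) (F : 'I_q -> A) x :
  \prod_(j < q) F j ^+ counts x j = \prod_(i < d) F (x i).
Proof.
rewrite [RHS](partition_big x predT) //=; apply: eq_bigr => j _.
rewrite countsE -prodr_const; apply: eq_big => [k|k]; first by rewrite inE.
by rewrite inE => /eqP ->.
Qed.

Lemma counts_eqP x y : counts x = counts y -> exists s, x = permute s y.
Proof.
move=> xy.
(* The multiplicity of each value j in the two tuples is the j-th count. *)
have : perm_eq [tuple x i | i < d] [tuple y i | i < d].
  apply/allP => j _ /=; apply/eqP; rewrite !count_map -!size_filter.
  have := congr1 (fun m : multinom q => m j) xy; rewrite !countsE !cardE.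
  rewrite !/(enum _) -!enumT /= => E.
  rewrite -(eq_filter (a1 := [in [set k | x k == j]%SET])); last first.
    by move=> k; rewrite !inE.
  by rewrite E; congr size; apply: eq_filter => k; rewrite !inE.
case/tuple_permP => s xs; exists s; apply/ffunP => i; rewrite ffunE.
by have /val_inj/(congr1 (fun t => tnth t i)) := xs; rewrite !tnth_mktuple.
Qed.

End TypeVectors.

(** * The multinomial theorem and the number of vectors with given counts *)

Section Counting.
Variables (F : numFieldType) (p : nat).
Local Notation q := p.+2.

(** The multinomial theorem, by induction on d. *)
Lemma mcoeff_sumX_exp d (m : multinom q) : mdeg m = d ->
  mcoeff m ((\sum_(j < q) mpolyX F (mnm1 j)) ^+ d) = mbinom F d m.
Proof.
elim: d m => [|d IHd] m dm.
  have -> : m = mnm0 by apply/eqP; rewrite -mdeg_eq0 dm.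
  rewrite expr0 mcoeff1 eqxx /mbinom big1 ?divr1 // => j _.
  by rewrite mnm0E.
(* Compare coefficients after differentiating in a variable occurring in m. *)
have [j mj] : exists j : 'I_q, (0 < m j)%N.
  apply/existsP; apply: contraT; rewrite negb_exists => /forallP m0.
  by move: dm; rewrite mdegE big1 // => j _; apply/eqP; rewrite -leqn0 leqNgt m0.
pose m' := mnm_sub m (mnm1 j).
have mE : m = mnm_add m' (mnm1 j) by rewrite submK // lep1mP -lt0n.
have dm' : mdeg m' = d by move: dm; rewrite {1}mE mdegD mdeg1 addn1 => -[].
have m'j : m j = (m' j).+1 by rewrite {1}mE mnmDE mnm1E eqxx addn1.
have dX : mderiv j (\sum_(k < q) mpolyX F (mnm1 k)) = 1.
  rewrite raddf_sum (bigD1 j) //= big1 ?addr0 => [|k kj].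
    by rewrite mderivX mnm1E eqxx scale1r -[X in mnm_sub X]add0m addmK mpolyX0.
  by rewrite mderivX mnm1E (negPf kj) scale0r.
have dXn n : mderiv j ((\sum_(k < q) mpolyX F (mnm1 k)) ^+ n.+1) =
    (\sum_(k < q) mpolyX F (mnm1 k)) ^+ n *+ n.+1.
  elim: n => [|n IHn]; first by rewrite expr1.
  by rewrite exprS mderivM dX mul1r IHn mulrnAr -exprS -mulrS.
have := mcoeff_deriv j m' ((\sum_(k < q) mpolyX F (mnm1 k)) ^+ d.+1).
rewrite dXn mcoeffMn -mE (IHd _ dm') => /eqP.
rewrite -mulr_natl -[X in _ == X]mulr_natl => /eqP E.
have nz : (m' j).+1%:R != 0 :> F by rewrite pnatr_eq0.
apply: (mulfI nz); rewrite -E /mbinom (bigD1 j) //= [in RHS](bigD1 j) //= m'j.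
have -> : \prod_(k < q | k != j) ((m k)`!)%:R =
    \prod_(k < q | k != j) ((m' k)`!)%:R :> F.
  apply: eq_bigr => k kj.
  by rewrite {1}mE mnmDE mnm1E eq_sym (negPf kj) addn0.
have nzP : \prod_(i < q | i != j) ((m' i)`!)%:R != 0 :> F.
  by apply/prodf_neq0 => i _; rewrite pnatr_eq0 -lt0n fact_gt0.
have nzf : ((m' j)`!)%:R != 0 :> F by rewrite pnatr_eq0 -lt0n fact_gt0.
rewrite !factS !natrM; move: nz nzP nzf.
move: _.+1%:R (\prod_(k < q | _) _) _`!%:R => a b c a0 b0 c0.
by field; rewrite a0 b0 c0.
Qed.

Lemma prod_mpolyX d (x : vec q d) :
  \prod_(i < d) mpolyX F (mnm1 (x i)) = mpolyX F (counts x).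
Proof.
by rewrite mpolyXE_id (prod_counts (fun j : 'I_q => mpolyX F (mnm1 j))).
Qed.

(** Expanding the d-th power of the sum of the variables by distributivity gives one monomial
    [counts x] for each vector x, so the multinomial coefficient counts vectors. *)
Lemma card_counts d (m : multinom q) : mdeg m = d ->
  (#|[set x : vec q d | counts x == m]%SET|)%:R = mbinom F d m.
Proof.
move=> dm; rewrite -(mcoeff_sumX_exp dm) -[X in _ ^+ X]card_ord -prodr_const.
rewrite bigA_distr_bigA raddf_sum /= -sum1_card natr_sum big_mkcond /=.
apply: eq_bigr => x _; rewrite prod_mpolyX mcoeffX inE.
by case: eqP.
Qed.
End Counting.

(** * Krawtchouk polynomials as sums of characters; duality and the dual generating function *)

Section KrawtchoukIdentities.
Variables (F : numFieldType) (p d : nat) (th : nat -> F).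
Local Notation q := p.+2.
Implicit Types (x r : vec q d) (l : multinom q.-1) (m : multinom q).

(** For [th] equal to [theta] these are the characters of (Z/q)^d. The identities of this section
    rest on [th 0 = 1] and on the symmetry [th a ^+ b = th b ^+ a]. *)
Definition chi r x : F := \prod_(k < d) th (r k) ^+ x k.

Lemma hcoefVE l : (hcoef F d l)^-1 = mbinom F d (mplus d (q := q) l).
Proof.
rewrite /hcoef /mbinom invrK big_ord_recl mplus0; congr (_ / (_ * _)).
by apply: eq_bigr => k _; rewrite mplusS.
Qed.

Lemma mbinom_neq0 m : mbinom F d m != 0.
Proof.
rewrite mulf_neq0 ?invr_eq0 ?pnatr_eq0 -?lt0n ?fact_gt0 //.
by apply/prodf_neq0 => j _; rewrite pnatr_eq0 -lt0n fact_gt0.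
Qed.

Lemma card_type_class l : (mdeg l <= d)%N ->
  #|type_class (q := q) d l|%:R = (hcoef F d l)^-1.
Proof. by move=> ld; rewrite hcoefVE -card_counts ?mdeg_mplus. Qed.

Lemma sum_counts_eq m (f : multinom q -> F) : mdeg m = d ->
  \sum_(x : vec q d | counts x == m) f (counts x) = mbinom F d m * f m.
Proof.
move=> dm; rewrite -card_counts // mulr_natl -sumr_const.
by apply: eq_big => x; rewrite ?inE // => /eqP ->.
Qed.

(** The number of such vectors is a multinomial coefficient, hence nonzero. *)
Lemma exists_counts m : mdeg m = d -> exists x : vec q d, counts x = m.
Proof.
move=> dm; have := mbinom_neq0 m; rewrite -card_counts // pnatr_eq0 -lt0n.
by case/card_gt0P => x; rewrite inE => /eqP <-; exists x.
Qed.

Hypothesis th0 : th 0 = 1.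

(** Coordinate i contributes the factor with j = x i. Choosing one summand in each factor amounts to
    choosing r, where r i = 0 stands for the constant term 1. *)
Lemma krawtchouk_gf_counts x :
  krawtchouk_gf th (counts x) =
  \sum_r chi r x *: mpolyX F (mminus (counts r)).
Proof.
(* [W a] is the variable w_a, with w_0 = 1, so that all summands of a factor have the same form. *)
pose W (a : 'I_q) := if unlift ord0 a is Some k then mpolyX F (mnm1 k) else 1.
rewrite /krawtchouk_gf.
rewrite (prod_counts (fun j : 'I_q =>
  1 + \sum_(k < q.-1) (th k.+1 ^+ j) *: mpolyX F (mnm1 k))).
transitivity (\prod_(i < d) \sum_(a < q) th a ^+ x i *: W a).
  apply: eq_bigr => i _; rewrite [RHS]big_ord_recl /W unlift_none th0 expr1n scale1r.
  by congr (1 + _); apply: eq_bigr => k _; rewrite liftK.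
rewrite bigA_distr_bigA; apply: eq_bigr => r _; rewrite scaler_prod.
rewrite -prod_counts big_ord_recl {1}/W unlift_none expr1n mul1r.
congr (_ *: _); rewrite mpolyXE_id; apply: eq_bigr => k _.
by rewrite /W liftK mminusE.
Qed.

Lemma krawtchouk_counts l x : (mdeg l <= d)%N ->
  krawtchouk th l (counts x) = \sum_(r in type_class d l) chi r x.
Proof.
move=> ld; rewrite /krawtchouk krawtchouk_gf_counts raddf_sum [RHS]big_mkcond /=.
apply: eq_bigr => r _; rewrite mcoeffZ mcoeffX type_classE //.
by case: eqP; rewrite ?mulr1 ?mulr0.
Qed.

Hypothesis th_sym : forall a b : nat, th a ^+ b = th b ^+ a.

Lemma chiC r x : chi r x = chi x r.
Proof. by apply: eq_bigr => k _; rewrite th_sym. Qed.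

(** By symmetry x may serve as the index of the character, and the vectors with counts m form the
    type class of [mminus m]. *)
Lemma sum_chi_counts m r : mdeg m = d ->
  \sum_(x | counts x == m) chi r x = krawtchouk th (mminus m) (counts r).
Proof.
move=> dm; rewrite krawtchouk_counts -?dm ?mdeg_mminus //.
by apply: eq_big => x; rewrite ?inE ?mminusK // chiC.
Qed.

(** Both sides are the double sum of [chi r x] over r of type l and x with counts m, taken in the
    two orders. *)
Lemma krawtchouk_duality l m : (mdeg l <= d)%N -> mdeg m = d ->
  mbinom F d m * krawtchouk th l m =
  mbinom F d (mplus d l) * krawtchouk th (mminus m) (mplus d l).
Proof.
move=> ld dm; rewrite -(sum_counts_eq (krawtchouk th l)) //.
rewrite -(sum_counts_eq (krawtchouk th (mminus m))) ?mdeg_mplus //.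
under eq_bigr do rewrite krawtchouk_counts //.
rewrite exchange_big /=; apply: eq_big => r; first by rewrite inE.
by move=> _; rewrite sum_chi_counts.
Qed.

(** With r of type l the polynomial is a product of one linear form per coordinate, and expanding it
    amounts to choosing x. *)
Lemma krawtchouk_dual_gf_counts r l : counts r = mplus d l ->
  krawtchouk_dual_gf th d l =
  (hcoef F d l)^-1 *: \sum_x chi r x *: mpolyX F (counts x).
Proof.
move=> rl; rewrite /krawtchouk_dual_gf; congr (_ *: _).
pose S (a : 'I_q) := \sum_(j < q) (th a ^+ j) *: mpolyX F (mnm1 j).
transitivity (\prod_(a < q) S a ^+ counts r a).
  rewrite big_ord_recl rl mplus0 /=; congr (_ ^+ _ * _).
    by apply: eq_bigr => j _; rewrite th0 expr1n scale1r.
  by apply: eq_bigr => k _; rewrite mplusS.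
rewrite prod_counts bigA_distr_bigA; apply: eq_bigr => x _.
by rewrite scaler_prod prod_mpolyX.
Qed.

(** For a fixed r of type l, the coefficient of m is the sum of [chi r x] over x with counts m,
    times h_l^-1: the right-hand side of the duality. *)
Lemma mcoeff_krawtchouk_dual_gf l m : (mdeg l <= d)%N -> mdeg m = d ->
  mcoeff m (krawtchouk_dual_gf th d l) = mbinom F d m * krawtchouk th l m.
Proof.
move=> ld dm; have [r rl] := exists_counts (mdeg_mplus (p:=p) ld).
rewrite (krawtchouk_dual_gf_counts rl) krawtchouk_duality // -rl -sum_chi_counts //.
rewrite mcoeffZ hcoefVE rl; congr (_ * _); rewrite raddf_sum [RHS]big_mkcond /=.
apply: eq_bigr => x _; rewrite mcoeffZ mcoeffX.
by case: eqP; rewrite ?mulr1 ?mulr0.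
Qed.

End KrawtchoukIdentities.

(** * Roots of unity and their orthogonality *)

Section Theta.
Variables (R : realType) (q : nat).
Hypothesis q_gt0 : (0 < q)%N.
Local Notation th := (theta R q).

Lemma theta0 : th 0 = 1.
Proof. by rewrite /theta mulr0 mul0r cos0 sin0. Qed.

Lemma thetaD a b : th (a + b)%N = th a * th b.
Proof.
rewrite /theta natrD mulrDr mulrDl cosD sinD.
by rewrite /GRing.mul /=; congr (_ +i* _); rewrite addrC.
Qed.

Lemma theta_exp a : th a = th 1 ^+ a.
Proof. by elim: a => [|a IHa]; rewrite ?theta0 // exprS -IHa -thetaD. Qed.

Lemma theta_sym a b : th a ^+ b = th b ^+ a.
Proof. by rewrite (theta_exp a) (theta_exp b) -!exprM mulnC. Qed.

(** By symmetry the power equals [th q ^+ a], and [th q] has angle 2 pi. *)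
Lemma theta_order a : th a ^+ q = 1.
Proof.
rewrite theta_sym /theta -mulrA divff ?pnatr_eq0 ?gtn_eqF // mulr1.
by rewrite mulr_natl cos2pi sin2pi expr1n.
Qed.

Lemma theta_eq1 a : (a < q)%N -> (th a == 1) = (a == 0%N).
Proof.
move=> aq; apply/idP/eqP => [|->]; last by rewrite theta0.
case: a aq => // a aq /eqP[/eqP + _].
(* Only real parts are compared. The angle is 2t with 0 < t < pi, and cos 2t = 1 would force sin t =
   0. *)
pose t : R := pi * (a.+1%:R / q%:R).
have -> : 2 * pi * a.+1%:R / q%:R = t *+ 2 :> R.
  by rewrite -[RHS]mulr_natl /t !mulrA.
rewrite cos_mulr2n.
suff t0 : 0 < sin t.
  rewrite cos2sin2 subr_eq -mulr2n eqr_pMn2r // subr_eq eq_sym addrC -subr_eq0 addrK.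
  by rewrite expf_eq0 gt_eqF.
have q0 : 0 < q%:R :> R by rewrite ltr0n.
apply: sin_gt0_pi; rewrite /t mulr_gt0 ?pi_gt0 ?divr_gt0 ?ltr0n //=.
by rewrite -[ltRHS]mulr1 ltr_pM2l ?pi_gt0 // ltr_pdivrMr // mul1r ltr_nat.
Qed.

Lemma theta_inj_le a b : (a <= b)%N -> (b < q)%N -> th a = th b -> a = b.
Proof.
move=> ab bq; rewrite -{1}(subnKC ab) thetaD -[LHS]mulr1 => /mulfI E.
have th_neq0 : th a != 0.
  apply: contra_eq_neq (theta_order a) => ->.
  by rewrite expr0n gtn_eqF // eq_sym oner_eq0.
have /eqP := esym (E th_neq0).
rewrite theta_eq1 ?subn_eq0 => [ba|].
  by apply/eqP; rewrite eqn_leq ab.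
exact: leq_ltn_trans (leq_subr _ _) bq.
Qed.

Lemma theta_inj a b : (a < q)%N -> (b < q)%N -> th a = th b -> a = b.
Proof.
move=> aq bq ab; case/orP: (leq_total a b) => [le|ge]; first exact: theta_inj_le.
exact/esym/theta_inj_le.
Qed.

(** The modulus is a nonnegative real whose q-th power is 1. *)
Lemma conj_theta a : (th a)^* * th a = 1.
Proof.
have : `|th a| ^+ q = 1 by rewrite -normrX theta_order normr1.
move=> /eqP; rewrite pexpr_eq1 // => /eqP n1.
by rewrite mulrC -normCK n1 expr1n.
Qed.

(** A geometric sum with ratio u satisfying u^q = 1; by injectivity of [theta] below q, u = 1 only
    when a = b. *)
Lemma sum_theta a b : (a < q)%N -> (b < q)%N ->
  \sum_(j < q) th a ^+ j * (th b ^+ j)^* = if a == b then q%:R else 0.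
Proof.
move=> aq bq; pose u := th a * (th b)^*.
rewrite (eq_bigr (fun j : 'I_q => u ^+ j)); last first.
  by move=> j _; rewrite exprMn rmorphXn.
case: eqP => [ab|/eqP ab].
  rewrite /u ab mulrC conj_theta; under eq_bigr do rewrite expr1n.
  by rewrite sumr_const card_ord.
have u1 : u - 1 != 0.
  apply: contra_neq ab => /eqP; rewrite subr_eq0 => /eqP u1.
  apply: theta_inj => //.
  by rewrite -[RHS]mul1r -u1 -mulrA conj_theta mulr1.
apply: (mulfI u1); rewrite -subrX1 mulr0 exprMn -rmorphXn !theta_order.
by rewrite rmorph1 mulr1 subrr.
Qed.
End Theta.

(** * Orthogonality of characters and of Krawtchouk polynomials *)

Section Characters.
Variables (R : realType) (p d : nat).
Local Notation q := p.+2.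
Local Notation C := R[i].
Local Notation th := (theta R q).
Implicit Types (x y z r : vec q d) (l : multinom q.-1) (m n : multinom q).

(** The sum factors over coordinates, and a coordinate where r and r' differ gives a factor 0. *)
Lemma chi_sum r r' :
  \sum_x chi th r x * (chi th r' x)^* = if r == r' then (q%:R ^+ d : C) else 0.
Proof.
pose f (k : 'I_d) (a : 'I_q) : C := th (r k) ^+ a * (th (r' k) ^+ a)^*.
transitivity (\sum_(x : vec q d) \prod_(k < d) f k (x k)).
  by apply: eq_bigr => x _; rewrite rmorph_prod -big_split.
rewrite -(bigA_distr_bigA f).
rewrite (eq_bigr (fun k => if r k == r' k then q%:R else 0)); last first.
  by move=> k _; rewrite /f sum_theta.
case: eqP => [->|/eqP].
  by under eq_bigr do rewrite eqxx; rewrite prodr_const card_ord.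
move=> /eqP rr'; have [k rk] : exists k, r k != r' k.
  apply/existsP; apply: contra_notT rr'; rewrite negb_exists => /forallP E.
  by apply/ffunP => k; apply/eqP; have := E k; rewrite negbK.
by rewrite (bigD1 k) //= (negPf rk) mul0r.
Qed.

(** Reduction modulo q does not change the powers, since each [theta] is a q-th root of unity. *)
Lemma chi_addr r x y : chi th r (x + y) = chi th r x * chi th r y.
Proof.
rewrite -big_split; apply: eq_bigr => k _.
by rewrite ffunE /= expr_mod ?theta_order // exprD.
Qed.

Lemma chi_permute (s : 'S_d) r x :
  chi th (permute s r) (permute s x) = chi th r x.
Proof.
rewrite [RHS](reindex_inj (@perm_inj _ s)).
by apply: eq_bigr => k _; rewrite !ffunE.
Qed.

(** Its inverse is the cardinality of a type class. *)
Lemma hcoef_conj l : (mdeg l <= d)%N -> (hcoef C d l)^* = hcoef C d l.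
Proof.
move=> ld; apply: invr_inj; rewrite -fmorphV -card_type_class //.
exact: rmorph_nat.
Qed.

Lemma mbinom_conj m : mdeg m = d -> (mbinom C d m)^* = mbinom C d m.
Proof. by move=> dm; rewrite -card_counts // rmorph_nat. Qed.

Let th_sym := @theta_sym R q.
Let th0 := @theta0 R q.

Lemma chi_sum_dual x y :
  \sum_r chi th r x * (chi th r y)^* = if x == y then (q%:R ^+ d : C) else 0.
Proof.
rewrite -chi_sum; apply: eq_bigr => r _.
by rewrite (chiC th_sym r x) (chiC th_sym r y).
Qed.

(** Fourier inversion: the Krawtchouk value is the sum of [chi r y] over y with counts n, and
    summing over r keeps only y = x. *)
Lemma counts_indicator x n : mdeg n = d ->
  (q%:R ^+ d : C) * (counts x == n)%:R =
  \sum_r chi th r x * (krawtchouk th (mminus n) (counts r))^*.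
Proof.
move=> dn; under eq_bigr do rewrite -sum_chi_counts // rmorph_sum mulr_sumr /=.
rewrite exchange_big /=.
under [RHS]eq_bigr do rewrite chi_sum_dual.
rewrite -big_mkcondr /=; case: eqP => [xn|xn].
  rewrite mulr1 (big_pred1 x) // => y /=; rewrite [x == y]eq_sym andbC.
  by case: eqP => // ->; rewrite xn eqxx.
rewrite mulr0 big1 // => y /andP[/eqP yn /eqP xy]; by case: xn; rewrite xy.
Qed.

(** The type of r as an element of a finite type, so that sums over vectors can be partitioned by
    it. *)
Definition bmtype r : bmultinom q.-1 d.+1 :=
  @BMultinom _ d.+1 (mminus (counts r))
    (leq_trans (mdeg_mminus (counts r)) (eq_leq (mdeg_counts r))).

Lemma sum_by_type (f : vec q d -> C) :
  \sum_r f r = \sum_(l : bmultinom q.-1 d.+1) \sum_(r in type_class d l) f r.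
Proof.
rewrite (partition_big bmtype predT) //=; apply: eq_bigr => l _.
apply: eq_bigl => r; rewrite type_classE; last by rewrite -ltnS bmdeg.
by rewrite -val_eqE.
Qed.

(** Both polynomials are expanded into characters, and only pairs r = r' survive. There are h_l^-1
    of them when l = l', and none otherwise because distinct type classes are disjoint. *)
Lemma krawtchouk_orthogonal l l' : (mdeg l <= d)%N -> (mdeg l' <= d)%N ->
  \sum_(x : vec q d) krawtchouk th l (counts x) * (krawtchouk th l' (counts x))^* =
  if l == l' then q%:R ^+ d / hcoef C d l else 0.
Proof.
move=> ld ld'.
transitivity (\sum_(r in type_class d l) \sum_(r' in type_class d l')
   if r == r' then (q%:R ^+ d : C) else 0).
  under [RHS]eq_bigr do under eq_bigr do rewrite -chi_sum.
  under [RHS]eq_bigr do rewrite exchange_big.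
  rewrite exchange_big /=; apply: eq_bigr => x _.
  rewrite !krawtchouk_counts // rmorph_sum mulr_suml.
  by apply: eq_bigr => r _; rewrite mulr_sumr.
case: eqP => [<-|ll'].
  rewrite -card_type_class // mulr_natr -sumr_const; apply: eq_bigr => r rl.
  rewrite -big_mkcondr (big_pred1 r) // => r' /=; rewrite [r == r']eq_sym andbC.
  by case: eqP => // ->.
apply: big1 => r rl; apply: big1 => r' rl'; case: eqP => // rr'; case: ll'.
by move: rl rl'; rewrite -rr' !type_classE // => /eqP <- /eqP <-.
Qed.

Lemma type_class0 : type_class (q := q) d mnm0 = [set 0]%SET.
Proof.
apply/setP => r; rewrite type_classE ?mdeg0 // inE; apply/eqP/eqP => [r0|->].
  apply/ffunP => i; rewrite ffunE; case: (unliftP ord0 (r i)) => [k rk|//].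
  have := congr1 (fun m : multinom q.-1 => m k) r0.
  rewrite mminusE countsE mnm0E => /eqP; rewrite cards_eq0 => /eqP/setP/(_ i).
  by rewrite !inE rk eqxx.
apply/mnmP => k; rewrite mminusE countsE mnm0E; apply/eqP; rewrite cards_eq0.
by apply/eqP/setP => i; rewrite !inE ffunE.
Qed.

Lemma chi0 x : chi th 0 x = 1.
Proof. by apply: big1 => k _; rewrite ffunE th0 expr1n. Qed.

Lemma krawtchouk0 m : mdeg m = d -> krawtchouk th mnm0 m = 1.
Proof.
case/(exists_counts C) => x <-.
by rewrite (@krawtchouk_counts _ _ d) ?mdeg0 // type_class0 big_set1 chi0.
Qed.

Lemma hcoef0 : hcoef C d (mnm0 : multinom q.-1) = 1.
Proof. by rewrite -[LHS]invrK -card_type_class ?mdeg0 // type_class0 cards1 invr1. Qed.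

(** * Spectral expansion for a permutation-invariant weight *)

Section Weights.
Variable w : vec q d -> C.
Hypothesis w_permute : forall s z, w (permute s z) = w z.
Hypothesis w_sum : \sum_z w z = 1.

(** One vector is a permutation of the other, and reindexing z by the same permutation changes
    neither the weight nor the character. *)
Lemma sum_weight_chi r r' : counts r = counts r' ->
  \sum_z w z * chi th r z = \sum_z w z * chi th r' z.
Proof.
case/counts_eqP => s ->; have inj : injective (permute (q := q) s).
  move=> x y xy; apply/ffunP => k; have := congr1 (fun f : vec q d => f (s^-1 k)%g) xy.
  by rewrite !ffunE permKV.
rewrite (reindex_inj inj); apply: eq_bigr => z _.
by rewrite w_permute chi_permute.
Qed.

(** The left side averages over the class of l, of size h_l^-1, a quantity that is constant on
    it. *)
Lemma sum_weight_type l r : (mdeg l <= d)%N -> r \in type_class d l ->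
  hcoef C d l * \sum_z w z * \sum_(r' in type_class d l) chi th r' z =
  \sum_z w z * chi th r z.
Proof.
move=> ld rl; under eq_bigr do rewrite mulr_sumr.
rewrite exchange_big /= (eq_bigr (fun=> \sum_z w z * chi th r z)) => [|r' rl'].
  rewrite sumr_const -mulr_natl mulrA card_type_class // mulfV ?mul1r //.
  by rewrite -invr_eq0 hcoefVE mbinom_neq0.
by apply: sum_weight_chi; move: rl rl'; rewrite !inE => /eqP -> /eqP ->.
Qed.

Lemma spectral_expansion (kap : multinom q.-1 -> C) x n : mdeg n = d ->
  (forall l, (mdeg l <= d)%N -> kap l =
     hcoef C d l * \sum_z w z * \sum_(r in type_class d l) chi th r z) ->
  \sum_z w z * (counts (x + z) == n)%:R =
  uniform_multinomial C d n *
    (1 + \sum_(l : bmultinom q.-1 d.+1 | (0 < mdeg l)%N)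
       kap l * hcoef C d l * krawtchouk th l (counts x) * (krawtchouk th l n)^*).
Proof.
move=> dn kapE; rewrite /uniform_multinomial dn eqxx.
have qd0 : q%:R ^+ d != 0 :> C by rewrite expf_neq0 // pnatr_eq0.
have kap0 : kap mnm0 = 1.
  rewrite kapE ?mdeg0 // hcoef0 mul1r -w_sum; apply: eq_bigr => z _.
  by rewrite type_class0 big_set1 chi0 mulr1.
(* The term of index [l0] is 1, which accounts for the leading 1 of the expansion. *)
have [l0 l0E] : exists l0 : bmultinom q.-1 d.+1, l0 = mnm0 :> multinom _.
  exists (bmtype 0); apply/eqP.
  by rewrite /= -type_classE ?mdeg0 // type_class0 inE.
transitivity (mbinom C d n / q%:R ^+ d * \sum_(l : bmultinom q.-1 d.+1)
    kap l * hcoef C d l * krawtchouk th l (counts x) *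
    (krawtchouk th l n)^*); last first.
  congr (_ * _); rewrite (bigD1 l0) //= l0E kap0 hcoef0 !krawtchouk0 ?mdeg_counts //.
  rewrite rmorph1 !mulr1; congr (1 + _); apply: eq_bigl => l.
  by rewrite -val_eqE /= l0E -mdeg_eq0 lt0n.
(* The factor q^d allows Fourier inversion of the indicator; the sum over r is then grouped by
   type. *)
apply: (mulfI qd0); rewrite mulrA mulrCA mulfV // mulr1 mulr_sumr.
under eq_bigr do rewrite mulrCA counts_indicator // mulr_sumr.
rewrite exchange_big sum_by_type mulr_sumr; apply: eq_bigr => l _.
have ld : (mdeg l <= d)%N by rewrite -ltnS bmdeg.
rewrite krawtchouk_counts //.
transitivity (kap l * (hcoef C d l * mbinom C d n * krawtchouk th l n)^* *
  \sum_(r in type_class d l) chi th r x); last first.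
  by rewrite 2!rmorphM /= hcoef_conj // mbinom_conj //; ring.
rewrite mulr_sumr; apply: eq_bigr => r rl.
(* Duality turns h_l binom(d, n) Q_l(n) into the Fourier coefficient of the indicator at a vector r
   of type l. *)
rewrite -[hcoef _ _ _ * _ * _]mulrA krawtchouk_duality // -hcoefVE.
rewrite mulrA mulfV ?mul1r; last first.
  by rewrite -invr_eq0 hcoefVE mbinom_neq0.
have /eqP <- : counts r == mplus d l by rewrite inE in rl.
rewrite kapE // (sum_weight_type ld rl) mulrAC -mulrA mulr_suml.
apply: eq_bigr => z _; rewrite chi_addr; ring.
Qed.

End Weights.
End Characters.

(** * A representative of each type, constant on consecutive blocks *)

Section BlockVector.
Variables (p d : nat) (l : multinom p.+2.-1).
Local Notation q := p.+2.
Hypothesis ld : (mdeg l <= d)%N.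

Definition block_start (k : 'I_q.-1) := (\sum_(j < q.-1 | j < k) l j)%N.

Definition in_block (k : 'I_q.-1) (i : nat) :=
  (block_start k <= i < block_start k + l k)%N.

Lemma block_end_le (k : 'I_q.-1) : (block_start k + l k <= mdeg l)%N.
Proof.
rewrite mdegE [X in (_ <= X)%N](bigID (fun j : 'I_q.-1 => (j < k)%N)) /= leq_add2l.
by rewrite (bigD1 k) ?ltnn //= leq_addr.
Qed.

Lemma block_end_start (k k' : 'I_q.-1) :
  (k < k')%N -> (block_start k + l k <= block_start k')%N.
Proof.
move=> kk'; rewrite /block_start.
rewrite [X in (_ <= X)%N](bigID (fun j : 'I_q.-1 => (j < k)%N)) /=.
apply: leq_add.
  rewrite (eq_bigl (fun j : 'I_q.-1 => (j < k')%N && (j < k)%N)) // => j.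
  by case: ltnP => jk; rewrite ?andbF // (ltn_trans jk kk').
by rewrite (bigD1 k) ?ltnn ?kk' //= leq_addr.
Qed.

Lemma in_block_inj k k' i : in_block k i -> in_block k' i -> k = k'.
Proof.
move=> /andP[ki ik] /andP[k'i ik']; apply/val_inj.
have [/block_end_start kk'|/block_end_start kk'|//] := ltngtP k k'.
  by have := leq_trans (leq_trans ik kk') k'i; rewrite ltnn.
by have := leq_trans (leq_trans ik' kk') ki; rewrite ltnn.
Qed.

Lemma card_block k : #|[set i : 'I_d | in_block k i]%SET| = l k.
Proof.
rewrite -sum1_card; under eq_bigl do rewrite inE.
(* Since |l| <= d, the whole block lies among the d coordinates. *)
have kd := leq_trans (block_end_le k) ld.
transitivity (\sum_(block_start k <= i < block_start k + l k) 1)%N; last first.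
  by rewrite sum_nat_const_nat muln1 addKn.
rewrite (big_nat_widen _ _ d) // (big_nat_widenl _ 0%N) // big_mkord.
by apply: eq_bigl => i; rewrite /in_block andbC.
Qed.

(** The vector of type l whose character is the product in (v). Blocks are disjoint, so the picked
    index is the only candidate. *)
Definition block_vec : vec q d :=
  [ffun i : 'I_d => if [pick k | in_block k i] is Some k then lift ord0 k
                    else ord0].

Lemma block_vec_eq (i : 'I_d) k : (block_vec i == lift ord0 k) = in_block k i.
Proof.
rewrite ffunE; case: pickP => [k' k'i|no]; last by rewrite no.
rewrite (inj_eq (@lift_inj _ ord0)); apply/eqP/idP => [<- //|ki].
exact: in_block_inj k'i ki.
Qed.

Lemma counts_block_vec : counts block_vec = mplus d l.
Proof.
rewrite -[LHS](mminusK (mdeg_counts _)); congr mplus; apply/mnmP => k.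
rewrite mminusE countsE -card_block; apply: eq_card => i.
by rewrite !inE block_vec_eq.
Qed.

Lemma chi_block_vec (F : numFieldType) (th : nat -> F) (x : vec q d) :
  th 0 = 1 ->
  chi th block_vec x = \prod_(k < q.-1) th k.+1 ^+ block_sum l x k.
Proof.
move=> th0; pose f (k : 'I_q.-1) (i : 'I_d) :=
  if in_block k i then th k.+1 ^+ x i else 1.
transitivity (\prod_(k < q.-1) \prod_(i < d) f k i); last first.
  apply: eq_bigr => k _; rewrite /block_sum /= -big_mkcond /=.
  by rewrite -(big_morph _ (exprD (th k.+1)) (expr0 _)).
(* For a fixed coordinate, at most one block gives a factor other than 1. *)
rewrite exchange_big; apply: eq_bigr => i _ /=; rewrite ffunE.
case: pickP => [k ki|no]; last first.
  by rewrite th0 expr1n big1 // => k _; rewrite /f no.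
rewrite (bigD1 k) //= {1}/f ki big1 ?mulr1 // => k' kk'.
rewrite /f; case: ifP => // k'i; move: kk'.
by rewrite (in_block_inj k'i ki) eqxx.
Qed.

End BlockVector.

(** * Expectations of variables concentrated on finitely many atoms *)

Section DiscreteVariables.
Variables (R : realType) (dT dT' : measure_display).
Variables (T : measurableType dT) (T' : measurableType dT').
Variables (P : probability T R) (Y : {RV P >-> T'}).
Hypothesis measurable_all : forall A : set T', measurable A.

Lemma measurable_preim (A : set T') : measurable [set w | A (Y w)].
Proof. by rewrite -[X in measurable X]setTI; exact: measurable_funPT. Qed.

(** Finite additivity; injectivity of [g] makes the fibres disjoint. *)
Lemma prob_bigcup (I : finType) (g : I -> T') (E : set T) : injective g ->
  measurable E ->
  fine (P (E `&` [set w | range g (Y w)])) =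
  \sum_i fine (P (E `&` [set w | Y w = g i])).
Proof.
move=> g_inj mE.
have mEi i : measurable (E `&` [set w | Y w = g i]).
  by apply: measurableI => //; apply: (measurable_preim [set g i]).
have -> : E `&` [set w | range g (Y w)] =
    \bigcup_(i in [set` enum I]) (E `&` [set w | Y w = g i]).
  apply/seteqP; split=> [w [Ew [i _ gi]]|w [i _ [Ew /= ->]]].
    by exists i => /=; rewrite ?mem_enum.
  by split=> //; exists i.
rewrite measure_fin_bigcup //; last first.
  by move=> i j _ _ [w [[_ /= wi] [_ /= wj]]]; apply: g_inj; rewrite -wi -wj.
rewrite -fsbig_seq ?enum_uniq // big_enum /= -sum_fine // => i _.
exact: fin_num_measure.
Qed.

Section FiniteRange.
(** [g] lists atoms of total mass 1. The type T' may be infinite, as it is for count vectors. *)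
Variables (I : finType) (g : I -> T').
Hypothesis g_inj : injective g.
Hypothesis range_g : \sum_i fine (P [set w | Y w = g i]) = 1.

Lemma prob_range : P [set w | range g (Y w)] = 1%E.
Proof.
have := prob_bigcup g_inj measurableT; rewrite setTI.
under eq_bigr do rewrite setTI.
rewrite range_g => <-; rewrite fineK //; apply: fin_num_measure.
exact: (measurable_preim (range g)).
Qed.

(** Almost everywhere [h (Y w)] is a finite combination of indicators of the fibres of Y, which is
    integrated term by term. *)
Lemma expectation_discrete (h : T' -> R) :
  fine 'E_P[fun w => h (Y w)] = \sum_i fine (P [set w | Y w = g i]) * h (g i).
Proof.
rewrite unlock.
pose A i := [set w | Y w = g i].
have mA i : measurable (A i) by exact: (measurable_preim [set g i]).
have mh : measurable_fun setT (EFin \o (fun w => h (Y w))).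
  by move=> _ B mB; rewrite setTI; exact: (measurable_preim (fun y => B (h y)%:E)).
have iA i : P.-integrable setT (fun w => ((h (g i))%:E * (\1_(A i) w)%:E)%E).
  by apply: integrableZl => //; exact: integrable_indic.
rewrite (@ae_eq_integral _ _ _ P setT
    (fun w => \sum_i ((h (g i))%:E * (\1_(A i) w)%:E)%E)) //; first last.
(* The exceptional set, where Y takes none of the listed values, has probability 0. *)
- exists (~` [set w | range g (Y w)]); split.
  + by apply: measurableC; exact: (measurable_preim (range g)).
  + rewrite [LHS]probability_setC ?prob_range ?subee //.
    exact: (measurable_preim (range g)).
  + apply: subsetC => w [i _ gi] _; rewrite (bigD1 i) //= big1 ?adde0.
      by rewrite indicE mem_set ?mule1 /A /= gi.
    move=> j ji; rewrite indicE memNset ?mule0 // /A /= -gi => /g_inj ij.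
    by rewrite ij eqxx in ji.
- by apply: measurable_int; apply: integrable_sum => //.
rewrite integral_sum // -sum_fine => [|i _]; last first.
  by apply: integrable_fin_num.
apply: eq_bigr => i _; rewrite integralZl ?integral_indic ?setIT //; last first.
  exact: integrable_indic.
rewrite fineM //; last exact: fin_num_measure.
exact: mulrC.
Qed.

Lemma cexpectation_discrete (f : T' -> R[i]) :
  cexpectation P (fun w => f (Y w)) =
  \sum_i (fine (P [set w | Y w = g i]))%:C * f (g i).
Proof.
rewrite /cexpectation (expectation_discrete (fun y => complex.Re (f y))).
rewrite (expectation_discrete (fun y => complex.Im (f y))).
elim/big_rec3: _ => // i a b c _ <-; case: (f (g i)) => u v.
by apply/eqP; rewrite eq_complex /= !mul0r subr0 addr0 !eqxx.
Qed.

End FiniteRange.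
End DiscreteVariables.

Lemma measurable_vec q d (A : set (vec q d)) : measurable A.
Proof. by []. Qed.

Lemma measurable_multinom q (A : set (multinom q)) : measurable A.
Proof. by []. Qed.

(** * Independence and one-step transitions of the walk *)

Section RandomWalk.
Variables (R : realType) (q d : nat) (dX : measure_display).
Variables (TX : measurableType dX) (P : probability TX R).
Variables (mu : set (vec q d) -> \bar R) (X Z : nat -> {RV P >-> vec q d}).
Hypothesis hX : random_walk mu X Z.

Lemma prob_sum_vec (Y : {RV P >-> vec q d}) (E : set TX) : measurable E ->
  fine (P E) = \sum_z fine (P (E `&` [set w | Y w = z])).
Proof.
move=> mE; rewrite -(prob_bigcup Y (@measurable_vec q d) (g := id)) //.
rewrite (_ : [set w | _] = setT) ?setIT //.
by apply/seteqP; split=> // w _; exists (Y w).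
Qed.

(** [X t] depends only on X_0 and the increments before time t. The induction on t conditions on the
    value z of Z_t: the event becomes X_t = x - z, and Z_t joins the family of later increments. *)
Lemma walk_independent t x (J : seq nat) (B : nat -> set (vec q d)) :
  uniq J -> all (leq t) J ->
  fine (P ([set w | X t w = x] `&` \bigcap_(i in [set` J]) (Z i @^-1` B i))) =
  fine (P [set w | X t w = x]) * \prod_(i <- J) fine (P (Z i @^-1` B i)).
Proof.
case: hX => _ indep step.
elim: t x J B => [|t IHt] x J B uJ tJ.
  (* In the joint family index 0 is X_0 and index i + 1 is Z_i. *)
  pose J' := 0%N :: map succn J.
  pose B' i := if i is i'.+1 then B i' else [set x].
  have uJ' : uniq J'.
    rewrite /= map_inj_uniq // ?uJ ?andbT; last by move=> ? ? [].
    by apply/negP => /mapP[].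
  have := indep J' B' uJ' (fun _ => measurable_vec _).
  rewrite big_cons big_map => <-; congr (fine (P _)).
  apply/seteqP; split=> w.
    move=> [Xw Zw] i /=; rewrite inE => /orP[/eqP -> //|/mapP[j jJ ->]].
    exact: (Zw j).
  move=> Yw; split; first exact: (Yw 0%N).
  move=> j /= jJ; apply: (Yw j.+1) => /=.
  by rewrite inE mem_map // => ? ? [].
have mX (s : nat) y : measurable [set w | X s w = y].
  exact: (measurable_preim (X s) (@measurable_vec q d) [set y]).
have mZ (K : seq nat) (D : nat -> set (vec q d)) :
    measurable (\bigcap_(i in [set` K]) (Z i @^-1` D i)).
  apply: bigcap_measurableType => // i _.
  exact: (measurable_preim (Z i) (@measurable_vec q d)).
(* The first factor does not depend on K; the case of empty K then identifies it as the probability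
   of X_(t+1) = x. *)
have stepE (K : seq nat) (D : nat -> set (vec q d)) : uniq K -> all (leq t.+1) K ->
    fine (P ([set w | X t.+1 w = x] `&` \bigcap_(i in [set` K]) (Z i @^-1` D i))) =
    (\sum_z fine (P [set w | X t w = x - z]) * fine (P [set w | Z t w = z])) *
    \prod_(i <- K) fine (P (Z i @^-1` D i)).
  move=> uK tK; rewrite (prob_sum_vec (Z t)); last exact: measurableI.
  have tK' : t \notin K by apply/negP => /(allP tK); rewrite ltnn.
  have atK : all (leq t) (t :: K).
    by rewrite /= leqnn; apply: sub_all tK => i /ltnW.
  rewrite mulr_suml; apply: eq_bigr => z _.
  pose D' i := if i == t then [set z] else D i.
  have DD' i : i \in K -> D' i = D i.
    by rewrite /D'; case: eqP => // -> /(negP tK').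
  transitivity (fine (P ([set w | X t w = x - z] `&`
      \bigcap_(i in [set` t :: K]) (Z i @^-1` D' i)))).
    congr (fine (P _)); apply/seteqP; split=> w.
      move=> [[Xw Zw] Ztw]; split => /=.
        by rewrite -Xw step -Ztw addrK.
      move=> i /=; rewrite inE => /orP[/eqP ->|iK]; first by rewrite /D' eqxx.
      by rewrite /= DD' //; apply: Zw.
    move=> [Xw Zw]; have Ztw : Z t w = z.
      by have := Zw t; rewrite /= /D' eqxx; apply => /=; rewrite mem_head.
    split => //; split; first by rewrite /= step Xw Ztw subrK.
    move=> i iK; have := Zw i; rewrite /= DD' //; apply.
    by rewrite /= inE iK orbT.
  rewrite IHt //=; last by rewrite tK' uK.
  rewrite big_cons mulrA /D' eqxx; congr (_ * _).
  by rewrite !big_seq; apply: eq_bigr => i iK; rewrite -/(D' i) DD'.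
rewrite stepE //; congr (_ * _).
have := stepE [::] B isT isT; rewrite big_nil mulr1 => <-.
congr (fine (P _)); rewrite (_ : \bigcap_(i in _) _ = setT) ?setIT //.
by rewrite set_nil bigcap_set0.
Qed.

Lemma walk_increment t x z :
  fine (P ([set w | X t w = x] `&` [set w | Z t w = z])) =
  fine (P [set w | X t w = x]) * fine (mu [set z]).
Proof.
have := @walk_independent t x [:: t] (fun=> [set z]) isT.
rewrite /= leqnn => /(_ isT); rewrite big_seq1.
have [hZ _ _] := hX; rewrite -(hZ t) => <-; congr (fine (P (_ `&` _))).
rewrite [RHS](_ : _ = \bigcap_(i in [set t]) (Z i @^-1` [set z])).
  by rewrite bigcap_set1.
by congr bigcap; apply/seteqP; split=> i /=; rewrite inE => /eqP.
Qed.

(** Total probability over the values of X_t and then of Z_t, which are independent. *)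
Lemma walk_transition t (D E : {set vec q d}) :
  fine (P ([set w | X t.+1 w \in E] `&` [set w | X t w \in D])) =
  \sum_(x in D) fine (P [set w | X t w = x]) *
    \sum_z fine (mu [set z]) * (x + z \in E)%:R.
Proof.
have [_ _ step] := hX.
have mXZ (Y : {RV P >-> vec q d}) (A : set (vec q d)) : measurable [set w | A (Y w)].
  exact: (measurable_preim Y (@measurable_vec q d)).
rewrite (prob_sum_vec (X t)); last first.
  by apply: measurableI; [exact: (mXZ _ [set` E])|exact: (mXZ _ [set` D])].
rewrite [RHS]big_mkcond; apply: eq_bigr => x _.
case: ifPn => xD; last first.
  rewrite (_ : _ `&` _ `&` _ = set0) ?measure0 //.
  by apply/seteqP; split=> w // [[_ /=] + xw]; rewrite xw (negPf xD).
rewrite (prob_sum_vec (Z t)); last first.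
  apply: measurableI; last exact: (mXZ _ [set x]).
  by apply: measurableI; [exact: (mXZ _ [set` E])|exact: (mXZ _ [set` D])].
rewrite mulr_sumr; apply: eq_bigr => z _; rewrite mulrA -walk_increment.
case: (boolP (x + z \in E)) => xzE; rewrite ?mulr1 ?mulr0.
  congr (fine (P _)); apply/seteqP; split=> w [].
    by move=> [_ /= xw] zw.
  by move=> /= xw zw; rewrite step xw zw.
rewrite (_ : _ `&` _ = set0) ?measure0 //.
apply/seteqP; split=> w // [[[/= + _] xw] zw].
by rewrite step xw zw (negPf xzE).
Qed.

End RandomWalk.

(** * Eigenvalues and transition function for an exchangeable increment *)

Section ExchangeableIncrement.
Variables (R : realType) (p d : nat) (dV : measure_display).
Local Notation q := p.+2.
Local Notation th := (theta R q).
Variables (TV : measurableType dV) (P : probability TV R).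
Variable V : {RV P >-> vec q d}.
Hypothesis hV : exchangeable V.

Let w (z : vec q d) : R[i] := (fine (P [set u | V u = z]))%:C.

Lemma law_sum : \sum_z fine (P [set u | V u = z]) = 1.
Proof.
have := prob_sum_vec V measurableT; rewrite probability_setT /= => ->.
by apply: eq_bigr => z _; rewrite setTI.
Qed.

Let w_sum : \sum_z w z = 1.
Proof. by rewrite -rmorph_sum law_sum. Qed.

(** Exchangeability on a singleton, combined with the injectivity of [permute s]. *)
Let w_permute s z : w (permute s z) = w z.
Proof.
congr (_%:C); have := congr1 (fun m => m [set permute s z]) (hV s) => /= E.
rewrite -[P [set u | V u = permute s z]]E; congr (fine (P _)).
apply/seteqP; split=> u /= => [/ffunP|->] // VE.
apply/ffunP => k; have := VE (s^-1 k)%g.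
by rewrite !ffunE permKV.
Qed.

Lemma cexpectation_vec (f : vec q d -> R[i]) :
  cexpectation P (fun u => f (V u)) = \sum_z w z * f z.
Proof.
exact: (cexpectation_discrete (@measurable_vec _ _) (g := id) _ law_sum).
Qed.

Lemma kappaE l : kappa V l =
  hcoef R[i] d l * \sum_z w z * \sum_(r in type_class d l) chi th r z.
Proof. by rewrite -cexpectation_vec. Qed.

(** The eigenvalue is the expectation of [chi r V] for any r of type l; here r is the block
    vector. *)
Lemma kappa_block_sum l : (mdeg l <= d)%N ->
  kappa V l =
  cexpectation P (fun u => \prod_(k < q.-1) th k.+1 ^+ block_sum l (V u) k).
Proof.
move=> ld.
rewrite (cexpectation_vec (fun z => \prod_(k < q.-1) th k.+1 ^+ block_sum l z k)).
rewrite kappaE (@sum_weight_type _ _ _ _ w_permute _ (block_vec d l)) //; last first.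
  by rewrite inE counts_block_vec.
by apply: eq_bigr => z _; rewrite chi_block_vec // theta0.
Qed.

(** From every x with counts m, the walk reaches counts n with the same probability, given by the
    expansion. Averaging over the law of X_t on these x leaves it unchanged, whatever that law
    is. *)
Lemma walk_cond_prob (dX : measure_display) (TX : measurableType dX)
    (PX : probability TX R) (X Z : nat -> {RV PX >-> vec q d}) t m n :
  random_walk (distribution P V) X Z -> mdeg n = d ->
  PX [set u | counts (X t u) = m] != 0%E ->
  (cond_prob PX [set u | counts (X t.+1 u) = n]
                [set u | counts (X t u) = m])%:C =
  uniform_multinomial R[i] d n *
    (1 + \sum_(l : bmultinom q.-1 d.+1 | (0 < mdeg l)%N)
           kappa V l * hcoef R[i] d l * krawtchouk th l m *
           (krawtchouk th l n)^*).
Proof.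
move=> hX dn Pm0.
have countsXE s k : [set u | counts (X s u) = k] =
    [set u | X s u \in [set x | counts x == k]%SET].
  by apply/seteqP; split=> u /=; rewrite inE => /eqP.
have mX s k : measurable [set u | counts (X s u) = k].
  exact: (measurable_preim (X s) (@measurable_vec _ _) [set x | counts x = k]).
have PmE : fine (PX [set u | counts (X t u) = m]) =
    \sum_(x : vec q d | counts x == m) fine (PX [set u | X t u = x]).
  rewrite (prob_sum_vec (X t)) // [RHS]big_mkcond; apply: eq_bigr => x _.
  case: eqP => xm.
    by congr (fine (PX _)); apply/seteqP; split=> u /= => [[]|Xu] //; rewrite Xu.
  rewrite (_ : _ `&` _ = set0) ?measure0 //.
  by apply/seteqP; split=> u //= -[+ Xu]; rewrite Xu.
have fPm0 : fine (PX [set u | counts (X t u) = m]) != 0.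
  by rewrite fine_eq0 //; exact: fin_num_measure.
rewrite /cond_prob !countsXE (walk_transition hX) -!countsXE rmorphM fmorphV /=.
rewrite rmorph_sum /=; set K := RHS.
(* The common value [K] factors out, and the remaining mass cancels the denominator. *)
rewrite (eq_bigr (fun x => (fine (PX [set u | X t u = x]))%:C * K)).
  rewrite -mulr_suml -rmorph_sum mulrAC (eq_bigl (fun x => counts x == m)).
    rewrite -PmE mulfV ?mul1r // fmorph_eq0; exact: fPm0.
  by move=> x; rewrite inE.
move=> x; rewrite inE => /eqP xm; rewrite rmorphM; congr (_ * _).
rewrite /K -xm -(spectral_expansion w_permute w_sum _ dn (fun l _ => kappaE l)).
rewrite rmorph_sum; apply: eq_bigr => z _.
by rewrite rmorphM rmorph_nat inE.
Qed.

End ExchangeableIncrement.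

(** * Expectations under the uniform multinomial law *)

Section UniformMultinomial.
Variables (p d : nat).
Local Notation q := p.+2.

(** The law is the image under [counts] of the uniform law on vectors. The index type also contains
    degrees below d, where the weight is 0 and no vector contributes. *)
Lemma sum_uniform_multinomial (F : numFieldType) (f : multinom q -> F) :
  \sum_(m : bmultinom q d.+1) uniform_multinomial F d m * f m =
  (q%:R ^+ d)^-1 * \sum_(x : vec q d) f (counts x).
Proof.
pose ct (x : vec q d) : bmultinom q d.+1 :=
  @BMultinom _ d.+1 (counts x) (eq_leq (congr1 S (mdeg_counts x))).
rewrite [X in _ = _ * X](partition_big ct predT) //= mulr_sumr.
apply: eq_bigr => m _; under eq_bigl do rewrite -val_eqE /=.
rewrite /uniform_multinomial; case: eqP => [dm|dm].
  by rewrite sum_counts_eq // mulrAC mulrC mulrAC mulrA.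
rewrite mul0r big1 ?mulr0 // => x /eqP xm; case: dm.
by rewrite -xm mdeg_counts.
Qed.

Variables (R : realType) (dM : measure_display) (TM : measurableType dM).
Variables (P : probability TM R) (M : {RV P >-> multinom q}).
Hypothesis hM : forall m, distribution P M [set m] = (uniform_multinomial R d m)%:E.

Lemma cexpectation_uniform (f : multinom q -> R[i]) :
  cexpectation P (fun u => f (M u)) =
  (q%:R ^+ d)^-1 * \sum_(x : vec q d) f (counts x).
Proof.
have PM m : fine (P [set u | M u = m]) = uniform_multinomial R d m.
  by have := hM m; rewrite /distribution /pushforward => ->.
rewrite (cexpectation_discrete (@measurable_multinom q)
  (g := fun m : bmultinom q d.+1 => m : multinom q)); first last.
(* Total mass 1 is the case f = 1, as there are q^d vectors. *)
- transitivity (\sum_(m : bmultinom q d.+1) uniform_multinomial R d m * 1).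
    by apply: eq_bigr => m _; rewrite PM mulr1.
  rewrite (sum_uniform_multinomial (fun=> 1)) sumr_const card_ffun card_ord.
  by rewrite natrX card_ord mulVf.
- by move=> m m' /val_inj.
rewrite -sum_uniform_multinomial; apply: eq_bigr => m _; rewrite PM.
(* The real and complex weights agree because both are the same quotient of natural numbers. *)
congr (_ * _); rewrite /uniform_multinomial; case: eqP => // dm.
by rewrite -!card_counts // rmorphM fmorphV rmorphXn !rmorph_nat.
Qed.

End UniformMultinomial.

Unset Implicit Arguments.
Set Strict Implicit.

Theorem proposition8 (R : realType) (q d : nat)
    (hq : (2 <= q)%N) (hd : (1 <= d)%N)
    (dV : measure_display) (TV : measurableType dV) (PV : probability TV R)
    (V : {RV PV >-> vec q d}) (hV : exchangeable V)
    (dX : measure_display) (TX : measurableType dX) (PX : probability TX R)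
    (X Z : nat -> {RV PX >-> vec q d})
    (hX : random_walk (distribution PV V) X Z)
    (hkappa : forall l : multinom q.-1,
        (mdeg l <= d)%N -> kappa V l \is Num.real) :
  [/\ (* (i) *)
      forall (t : nat) (m n : multinom q), mdeg m = d -> mdeg n = d ->
        PX [set w | counts (X t w) = m] != 0%E ->
        (cond_prob PX [set w | counts (X t.+1 w) = n]
                      [set w | counts (X t w) = m])%:C =
        uniform_multinomial R[i] d n *
          (1 + \sum_(l : bmultinom q.-1 d.+1 | (0 < mdeg l)%N)
                 kappa V l * hcoef R[i] d l *
                 krawtchouk (theta R q) l m *
                 (krawtchouk (theta R q) l n)^*),
      (* (ii) *)
      forall (dM : measure_display) (TM : measurableType dM)
             (PM : probability TM R) (M : {RV PM >-> multinom q}),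
        (forall m : multinom q,
           distribution PM M [set m] = (uniform_multinomial R d m)%:E) ->
        (forall l l' : multinom q.-1, (mdeg l <= d)%N -> (mdeg l' <= d)%N ->
           l != l' ->
           cexpectation PM (fun w => krawtchouk (theta R q) l (M w) *
                                    (krawtchouk (theta R q) l' (M w))^*) = 0) /\
        (forall l : multinom q.-1, (mdeg l <= d)%N ->
           cexpectation PM (fun w => krawtchouk (theta R q) l (M w) *
                                    (krawtchouk (theta R q) l (M w))^*) =
           (hcoef R[i] d l)^-1),
      (* (iii) *)
      forall (l : multinom q.-1) (m : multinom q),
        (mdeg l <= d)%N -> mdeg m = d ->
        mcoeff m (krawtchouk_dual_gf (theta R q) d l) =
        mbinom R[i] d m * krawtchouk (theta R q) l m,
      (* (iv) *)
      forall (l : multinom q.-1) (m : multinom q),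
        (mdeg l <= d)%N -> mdeg m = d ->
        mbinom R[i] d m * krawtchouk (theta R q) l m =
        mbinom R[i] d (mplus d l) *
          krawtchouk (theta R q) (mminus m) (mplus d l)
    & (* (v) *)
      forall l : multinom q.-1, (mdeg l <= d)%N ->
        kappa V l =
        cexpectation PV (fun w =>
          \prod_(k < q.-1) theta R q k.+1 ^+ block_sum l (V w) k)].
Proof.
(* The bound 2 <= q allows q to be written as p + 2, the form used in the preceding sections. *)
case: q hq V hV X Z hX hkappa => [//|[//|p]] _ V hV X Z hX _; split.
- by move=> t m n _ dn Pm; exact (walk_cond_prob hV hX dn Pm).
- move=> dM TM PM M hM; split=> [l l' ld ld' ll'|l ld].
    rewrite (cexpectation_uniform hM (fun m => krawtchouk (theta R p.+2) l m *
      (krawtchouk (theta R p.+2) l' m)^*)) krawtchouk_orthogonal //.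
    by rewrite (negPf ll') mulr0.
  rewrite (cexpectation_uniform hM (fun m => krawtchouk (theta R p.+2) l m *
    (krawtchouk (theta R p.+2) l m)^*)) krawtchouk_orthogonal // eqxx mulrA.
  by rewrite mulVf ?mul1r // expf_neq0 // pnatr_eq0.
- move=> l m ld dm; apply: mcoeff_krawtchouk_dual_gf => //.
    exact: theta0.
  exact: theta_sym.
- move=> l m ld dm; apply: krawtchouk_duality => //.
    exact: theta0.
  exact: theta_sym.
- move=> l ld; exact: kappa_block_sum.
Qed.
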